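(* Let $D$ be a strong Mori domain. Then $D$ is a $w$-Hilbert domain if and only if $D$ is a UMT domain.
   Context: Let $R$ be an integral domain with quotient field $F$ (applied to $R=D$ and to the polynomial ring $R=D[X]$). For a nonzero fractional ideal $I$ of $R$ put $I^{-1}=\{a\in F \mid aI\subseteq R\}$. A Glaz-Vasconcelos ideal (GV-ideal) of $R$ is a (nonzero) finitely generated ideal $J$ of $R$ with $J^{-1}=R$; the set of these is $\mathrm{GV}(R)$. The $w$-envelope of a nonzero fractional ideal $I$ is $I_w=\{a\in F \mid aJ\subseteq I \text{ for some } J\in \mathrm{GV}(R)\}$. An ideal $I$ of $R$ is a $w$-ideal if $I_w=I$; since the $w$-operation is defined only on nonzero fractional ideals, $w$-ideals are nonzero. A maximal $w$-ideal is a proper $w$-ideal that is not properly contained in any proper $w$-ideal. A prime $w$-ideal is an ideal that is both a prime ideal and a $w$-ideal (in particular, it is nonzero). $R$ is a $w$-Hilbert domain if every prime $w$-ideal of $R$ can be expressed as an intersection of maximal $w$-ideals of $R$. $R$ is a strong Mori domain if it satisfies the ascending chain condition on $w$-ideals. An upper to zero in $D[X]$ is a nonzero prime ideal $\mathfrak{q}$ of $D[X]$ with $\mathfrak{q}\cap D=(0)$. $D$ is a UMT domain if every upper to zero in $D[X]$ is a maximal $w$-ideal of $D[X]$. *)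

(* Defs.v *)
From HB Require Import structures.
From mathcomp Require Import all_boot all_order all_algebra.
From mathcomp Require Import boolp classical_sets.

Set Implicit Arguments.
Unset Strict Implicit.
Unset Printing Implicit Defensive.

Import GRing.Theory.

Local Open Scope classical_set_scope.
Local Open Scope ring_scope.

Section WIdeals.
Variable R : idomainType.

(* Ideals are not required to be proper. MathComp's [idealr_closed] builds
   properness in, so it is not usable here. *)
Definition is_ideal (I : set R) : Prop :=
  [/\ I 0, forall x y, I x -> I y -> I (x + y)
    & forall a x, I x -> I (a * x)].

Definition prime_ideal (P : set R) : Prop :=
  [/\ is_ideal P, P != setT & forall x y, P (x * y) -> P x \/ P y].

Definition fin_gen_ideal (J : set R) : Prop :=
  exists (n : nat) (g : 'I_n -> R),
    J = [set x | exists c : 'I_n -> R, x = \sum_(i < n) c i * g i].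

(* An ideal of R seen as a subset of the quotient field; [in_frac setT] is R. *)
Definition in_frac (I : set R) : set {fraction R} := @tofrac R @` I.

(* [frac_inv] and [w_envelope] are total on subsets of the quotient field, but
   are only meaningful (and only used) on nonzero fractional ideals. *)
Definition frac_inv (I : set {fraction R}) : set {fraction R} :=
  [set a | forall x, I x -> in_frac setT (a * x)].

Definition GV_ideal (J : set R) : Prop :=
  [/\ J != [set 0], fin_gen_ideal J & frac_inv (in_frac J) = in_frac setT].

Definition w_envelope (I : set {fraction R}) : set {fraction R} :=
  [set a | exists2 J, GV_ideal J & forall x, in_frac J x -> I (a * x)].

Definition w_ideal (I : set R) : Prop :=
  [/\ is_ideal I, I != [set 0] & w_envelope (in_frac I) = in_frac I].

Definition maximal_w_ideal (M : set R) : Prop :=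
  [/\ w_ideal M, M != setT
    & ~ exists N, [/\ w_ideal N, N != setT & M `<` N]].

Definition prime_w_ideal (P : set R) : Prop := prime_ideal P /\ w_ideal P.

End WIdeals.

Definition w_Hilbert_domain (R : idomainType) : Prop :=
  forall P : set R, prime_w_ideal P ->
    exists2 S : set (set R), S `<=` @maximal_w_ideal R
      & P = \bigcap_(M in S) M.

Definition strong_Mori_domain (R : idomainType) : Prop :=
  forall I : nat -> set R,
    (forall n, w_ideal (I n)) -> (forall n, I n `<=` I n.+1) ->
    exists N, forall n, (N <= n)%N -> I n = I N.

Definition upper_to_zero (D : idomainType) (q : set {poly D}) : Prop :=
  [/\ prime_ideal q, q != [set 0] & [set d : D | q d%:P] = [set 0]].

Definition UMT_domain (D : idomainType) : Prop :=
  forall q : set {poly D}, upper_to_zero q -> maximal_w_ideal q.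

(* Main.v *)
(* A nonzero prime contained in a proper w-ideal is a w-ideal, and the ideals of the
   localization of a strong Mori domain D at a prime w-ideal satisfy the ascending
   chain condition. Both properties of D are equivalent to every prime w-ideal
   being a maximal w-ideal.

   If D is w-Hilbert, let P be a prime w-ideal and 0 != a in P. A maximal w-ideal
   containing a has the form (aD : c), so by the chain condition a product of
   finitely many of those whose intersection is P lies in P; hence P is one of
   them.

   If D is UMT and 0 != P < M are prime w-ideals, choose f in M[X] whose
   coefficients generate M locally, and a prime q minimal over f in M[X]. By
   Hilbert's basis theorem and Krull's principal ideal theorem q has height at
   most 1, which forces q to be an upper to zero properly contained in the proper
   w-ideal M[X], a contradiction.

   Conversely, if prime w-ideals are maximal, then M[X] has height 1 for every
   prime w-ideal M, so no upper to zero q is contained in M[X]. If a proper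
   w-ideal N properly contains q, it contains some 0 != d in D; choosing g in q
   whose content lies in no prime w-ideal containing d, the ideal (d, g) is a
   GV-ideal contained in N, which is impossible. *)
Require Import Defs.
From HB Require Import structures.
From mathcomp Require Import all_boot all_order all_algebra.
From mathcomp Require Import boolp classical_sets.
From mathcomp Require Import ring zify.

Set Implicit Arguments.
Unset Strict Implicit.
Unset Printing Implicit Defensive.

Import GRing.Theory.

Local Open Scope classical_set_scope.
Local Open Scope ring_scope.

(** * Chain conditions and maximal elements *)

(** For the w-ideals this is [strong_Mori_domain]; the general form also serves the saturated
    ideals. *)
Definition acc T (C : set (set T)) : Prop :=
  forall I : nat -> set T,
    (forall n, C (I n)) -> (forall n, I n `<=` I n.+1) ->
    exists N, forall n, (N <= n)%N -> I n = I N.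

Lemma chain_mono T (I : nat -> set T) :
  (forall n, I n `<=` I n.+1) -> forall m n, (m <= n)%N -> I m `<=` I n.
Proof.
move=> Imon m n /subnK <-; elim: (n - m)%N => //= k IHk.
exact: subset_trans IHk (Imon _).
Qed.

(** Otherwise, choosing strictly larger members again and again from [I0] on gives a chain that
    never becomes stationary. *)
Lemma acc_max T (C F : set (set T)) (I0 : set T) :
  acc C -> F `<=` C -> F I0 ->
  exists I, F I /\ forall J, F J -> I `<=` J -> J = I.
Proof.
move=> accC FC FI0; apply: contrapT => noMax.
have step (I : {I | F I}) : exists J : {J | F J}, sval I `<` sval J.
  case: I => I FI /=; apply: contrapT => noJ; apply: noMax.
  exists I; split=> // J FJ IJ; apply: contrapT => JI; apply: noJ.
  by exists (exist _ J FJ); split=> // JsubI; apply: JI; apply/seteqP.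
have [f fP] := choice step.
pose I n := sval (iter n f (exist _ I0 FI0)).
have [|n|N IN] := accC I; first by move=> n; apply: FC; exact: svalP.
  by case: (fP (iter n f (exist _ I0 FI0))).
case: (fP (iter N f (exist _ I0 FI0))) => _; apply.
by have := IN N.+1 (leqnSn N); rewrite /I /= => ->.
Qed.

(** * Ideals, colon ideals and contractions from a localization *)

Section Ideals.
Variable R : idomainType.
Implicit Types I J K M P Q : set R.

Lemma ideal0 I : is_ideal I -> I 0. Proof. by case. Qed.
Lemma idealD I x y : is_ideal I -> I x -> I y -> I (x + y).
Proof. by case=> _ + _; apply. Qed.
Lemma ideal_mull I a x : is_ideal I -> I x -> I (a * x).
Proof. by case=> _ _; apply. Qed.
Lemma ideal_mulr I a x : is_ideal I -> I x -> I (x * a).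
Proof. by rewrite mulrC; apply: ideal_mull. Qed.
Lemma idealN I x : is_ideal I -> I x -> I (- x).
Proof. by rewrite -mulN1r; apply: ideal_mull. Qed.
Lemma idealB I x y : is_ideal I -> I x -> I y -> I (x - y).
Proof. by move=> iI Ix Iy; apply: idealD => //; apply: idealN. Qed.
Lemma ideal_sum I (T : Type) (r : seq T) (p : pred T) (F : T -> R) :
  is_ideal I -> (forall i, p i -> I (F i)) -> I (\sum_(i <- r | p i) F i).
Proof.
by move=> iI IF; apply: big_ind => //; [exact: ideal0|move=> x y; exact: idealD].
Qed.
Lemma ideal_unit I : is_ideal I -> I 1 -> I = setT.
Proof.
move=> iI I1; apply/seteqP; split=> // x _.
by rewrite -[x]mulr1; apply: ideal_mull.
Qed.
Lemma ideal_proper I : is_ideal I -> I != setT -> ~ I 1.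
Proof. by move=> iI /eqP + /(ideal_unit iI). Qed.
Lemma ideal_nonzero I x : I x -> x != 0 -> I != [set 0].
Proof. by move=> Ix x0; apply/eqP => I0; move: Ix x0; rewrite I0 /= => ->; rewrite eqxx. Qed.
Lemma nonzero_ideal I : is_ideal I -> I != [set 0] -> exists2 x, I x & x != 0.
Proof.
move=> iI /eqP I0; apply: contrapT => no; apply: I0; apply/seteqP; split.
  move=> x Ix /=; apply: contrapT => /eqP x0; apply: no; by exists x.
by move=> x /= ->; apply: ideal0.
Qed.

Lemma prime_is_ideal P : prime_ideal P -> is_ideal P. Proof. by case. Qed.
Lemma prime_proper P : prime_ideal P -> ~ P 1.
Proof. by case=> iP PT _; apply: ideal_proper. Qed.
Lemma prime_notM P x y : prime_ideal P -> ~ P x -> ~ P y -> ~ P (x * y).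
Proof. by case=> _ _ PM nx ny /PM []. Qed.
Lemma prime_X P x n : prime_ideal P -> P (x ^+ n) -> P x.
Proof.
move=> pP; elim: n => [|n IHn]; first by rewrite expr0 => /(prime_proper pP).
by rewrite exprS; case: (pP) => _ _ /[apply] -[].
Qed.
Lemma mkprime P : is_ideal P -> ~ P 1 -> (forall x y, P (x * y) -> ~ P x -> P y) ->
  prime_ideal P.
Proof.
move=> iP P1 PM; split=> // [|x y Pxy]; first by apply/eqP => PT; apply: P1; rewrite PT.
by have [Px|nPx] := EM (P x); [left|right; apply: PM nPx].
Qed.

Definition principal (d : R) : set R := [set x | exists c, x = d * c].
Definition colon I K : set R := [set x | forall k, K k -> I (x * k)].
(* The [M]-saturated ideals are the contractions of the ideals of the localization
   at the prime [M]; they replace the localization throughout. *)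
Definition saturated M I : Prop :=
  is_ideal I /\ forall s x, ~ M s -> I (s * x) -> I x.
(** For [M] prime and [I] an ideal, the contraction of [I R_M]. *)
Definition saturation M I : set R := [set x | exists2 s, ~ M s & I (s * x)].
Definition add_principal I (d : R) : set R :=
  [set x | exists y c, I y /\ x = y + d * c].

Lemma principal_ideal d : is_ideal (principal d).
Proof.
split; first by exists 0; rewrite mulr0.
  by move=> _ _ [x ->] [y ->]; exists (x + y); rewrite mulrDr.
by move=> a _ [x ->]; exists (a * x); rewrite mulrCA.
Qed.

Lemma principal_id d : principal d d. Proof. by exists 1; rewrite mulr1. Qed.

Lemma colon_ideal I K : is_ideal I -> is_ideal (colon I K).
Proof.
move=> iI; split=> [k|x y Ix Iy k Kk|a x Ix k Kk]; first by rewrite mul0r => _; apply: ideal0.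
  by rewrite mulrDl; apply: idealD; [|exact: Ix|exact: Iy].
by rewrite -mulrA; apply: ideal_mull => //; apply: Ix.
Qed.

Lemma sub_colon I K : is_ideal I -> I `<=` colon I K.
Proof. by move=> iI x Ix k _; apply: ideal_mulr. Qed.

Lemma add_principal_ideal I d : is_ideal I -> is_ideal (add_principal I d).
Proof.
move=> iI; split; first by exists 0, 0; rewrite mulr0 addr0; split=> //; exact: ideal0.
  move=> _ _ [x [c [Ix ->]]] [y [e [Iy ->]]]; exists (x + y), (c + e).
  by rewrite mulrDr addrACA; split=> //; apply: idealD.
move=> a _ [x [c [Ix ->]]]; exists (a * x), (a * c).
by rewrite mulrDr (mulrCA d); split=> //; apply: ideal_mull.
Qed.

Lemma sub_add_principal I d : I `<=` add_principal I d.
Proof. by move=> x Ix; exists x, 0; rewrite mulr0 addr0. Qed.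

Lemma add_principal_id I d : is_ideal I -> add_principal I d d.
Proof. by move=> iI; exists 0, 1; rewrite mulr1 add0r; split=> //; exact: ideal0. Qed.

Lemma saturation_saturated M I : prime_ideal M -> is_ideal I ->
  saturated M (saturation M I).
Proof.
move=> pM iI; split; last first.
  move=> s x Ms [t Mt]; rewrite mulrA => Itsx.
  by exists (t * s) => //; apply: prime_notM.
split; first by exists 1; [exact: prime_proper|rewrite mulr0; exact: ideal0].
  move=> x y [s Ms Isx] [t Mt Ity]; exists (s * t); first exact: prime_notM.
  have -> : s * t * (x + y) = t * (s * x) + s * (t * y) by ring.
  by apply: idealD => //; apply: ideal_mull.
move=> a x [s Ms Isx]; exists s => //; rewrite mulrCA; exact: ideal_mull.
Qed.

Lemma sub_saturation M I : prime_ideal M -> I `<=` saturation M I.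
Proof. by move=> pM x Ix; exists 1; [exact: prime_proper|rewrite mul1r]. Qed.

Lemma saturationS M I J : I `<=` J -> saturation M I `<=` saturation M J.
Proof. by move=> IJ x [s Ms Isx]; exists s => //; apply: IJ. Qed.

Lemma prime_saturated M P : prime_ideal P -> P `<=` M -> saturated M P.
Proof.
move=> pP PM; split=> [|s x Ms]; first exact: prime_is_ideal.
by case: (pP) => _ _ /[apply] -[/PM|].
Qed.

Lemma saturated_sub M I : saturated M I -> ~ I 1 -> I `<=` M.
Proof.
move=> [iI sI] I1 x Ix; apply: contrapT => Mx; apply: I1; apply: (sI x) => //.
by rewrite mulr1.
Qed.

Lemma colon_saturated M I K : saturated M I -> saturated M (colon I K).
Proof.
move=> [iI sI]; split=> [|s x Ms + k Kk]; first exact: colon_ideal.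
by move/(_ k Kk); rewrite -mulrA; apply: sI.
Qed.

(** The complement of [M] is the larger one, so [M]-saturated ideals are [N]-saturated. *)
Lemma acc_saturatedS M N : M `<=` N -> acc (saturated N) -> acc (saturated M).
Proof.
move=> MN accN I satI; apply: accN => n; case: (satI n) => iI sI; split=> // s x Ns.
by apply: sI => /MN.
Qed.

End Ideals.

(** * Extended ideals of the polynomial ring *)

Section PolyExt.
Variable R : idomainType.
Implicit Types I P Q : set R.

Definition poly_ext I : set {poly R} := [set p | forall i, I p`_i].

Lemma poly_ext_ideal I : is_ideal I -> is_ideal (poly_ext I).
Proof.
move=> iI; split=> [i|p q Ip Iq i|p q Iq i]; first by rewrite coef0; exact: ideal0.
  by rewrite coefD; apply: idealD.
by rewrite coefM; apply: ideal_sum => // j _; apply: ideal_mull.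
Qed.

Lemma poly_extC I c : is_ideal I -> poly_ext I c%:P <-> I c.
Proof.
move=> iI; split=> [/(_ 0%N)|Ic i]; first by rewrite coefC eqxx.
by rewrite coefC; case: eqP => // _; exact: ideal0.
Qed.

Lemma poly_ext_sub (I : set R) (N : set {poly R}) :
  is_ideal N -> (forall d, I d -> N d%:P) -> poly_ext I `<=` N.
Proof.
move=> iN IN p Ip; rewrite -[p]coefK poly_def; apply: ideal_sum => // i _.
by rewrite -mul_polyC; apply: ideal_mulr => //; apply: IN.
Qed.

(** The shift by [size p] separates the degrees: one polynomial carries the coefficients of both.
    This is how contents are added. *)
Lemma poly_ext_add (P : set R) (p q : {poly R}) : is_ideal P ->
  poly_ext P (p + 'X^(size p) * q) -> poly_ext P p /\ poly_ext P q.
Proof.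
move=> iP Pr; split=> i; last first.
  have := Pr (i + size p)%N; rewrite coefD coefXnM ltnNge leq_addl /= addnK.
  by rewrite nth_default ?add0r // leq_addl.
have [ip|pi] := ltnP i (size p); last by rewrite nth_default //; exact: ideal0.
by have := Pr i; rewrite coefD coefXnM ip addr0.
Qed.

Lemma poly_top_coef I (p : {poly R}) : is_ideal I -> ~ poly_ext I p ->
  exists2 j, ~ I p`_j & forall i, (j < i)%N -> I p`_i.
Proof.
move=> iI nIp; apply: contrapT => no; apply: nIp => i.
(* Descending induction on [i], starting where the coefficients vanish. *)
have [n] := ubnP (size p - i); elim: n i => // n IHn i ltin.
apply: contrapT => nIi; apply: no; exists i => // k ik.
have [kp|pk] := ltnP k (size p); first by apply: IHn; lia.
by rewrite nth_default //; exact: ideal0.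
Qed.

(* Gauss: modulo I, the product of the top coefficients is the top coefficient
   of the product. *)
Lemma poly_top_coefM I (p q : {poly R}) i j : is_ideal I ->
  (forall k, (i < k)%N -> I p`_k) -> (forall l, (j < l)%N -> forall k, I (p`_k * q`_l)) ->
  I (p * q)`_(i + j) -> I (p`_i * q`_j).
Proof.
move=> iI Ip Iq; rewrite coefM.
have ilt : (i < (i + j).+1)%N by rewrite ltnS leq_addr.
rewrite (bigD1 (Ordinal ilt)) //= addKn => Isum.
have {Isum} := idealB iI Isum; move=> H.
rewrite -[X in I X](addrK (\sum_(k < (i + j).+1 | k != Ordinal ilt) p`_k * q`_(i + j - k))).
apply: H; apply: ideal_sum => // k; rewrite -val_eqE /= => ki.
have [lt|le] := ltnP i k; first by apply: ideal_mulr => //; apply: Ip.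
by apply: Iq; move: (ltn_ord k); lia.
Qed.

Lemma poly_ext_prime P : prime_ideal P -> prime_ideal (poly_ext P).
Proof.
move=> pP; have iP := prime_is_ideal pP; apply: mkprime.
- exact: poly_ext_ideal.
- by rewrite -[1]/(1%:P) => /(poly_extC _ iP); exact: prime_proper.
move=> p q Ppq /(poly_top_coef iP) [i Pi Hi]; apply: contrapT => /(poly_top_coef iP) [j Pj Hj].
apply: (prime_notM pP Pi Pj); apply: (poly_top_coefM iP Hi _ (Ppq _)).
by move=> l jl k; apply: ideal_mull => //; apply: Hj.
Qed.

End PolyExt.

(** * The principal ideal theorem *)

Section PrincipalIdealTheorem.
Variable R : idomainType.
Implicit Types I J K M P Q : set R.

(* In the localization at [M], the maximal ideal is the radical of [(f)]. *)
Definition radical_of_principal M (f : R) : Prop :=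
  forall m, M m -> exists s k, ~ M s /\ principal f (s * m ^+ k).

(* Among the multiplicative sets [T] containing the complement of [M] and disjoint
   from [(f)], choose one for which the contraction [A] of [T^-1 (f)] is maximal.
   Enlarging [T] by an element that is not nilpotent modulo [A] does not change
   [A], so that every such element is a nonzerodivisor modulo [A]: the ideal [A] is
   primary, and its radical is the required prime. *)
Lemma prime_over_principal M f : prime_ideal M -> acc (saturated M) -> M f ->
  exists Q, [/\ prime_ideal Q, Q f, Q `<=` M & radical_of_principal Q f].
Proof.
move=> pM accM Mf.
pose mult (T : set R) := [/\ forall s, ~ M s -> T s,
  forall s t, T s -> T t -> T (s * t) & forall t, T t -> ~ principal f t].
pose A (T : set R) : set R := [set y | exists2 t, T t & principal f (t * y)].
have A_sat T : mult T -> saturated M (A T).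
  case=> MT TM _; have T1 : T 1 by apply: MT; exact: prime_proper.
  split; last first.
    move=> s x Ms [t Tt fx]; exists (t * s); last by rewrite -mulrA.
    by apply: TM => //; apply: MT.
  split; first by exists 1 => //; rewrite mulr0; exact: ideal0 (principal_ideal f).
    move=> x y [s Ts fx] [t Tt fy]; exists (s * t); first exact: TM.
    have -> : s * t * (x + y) = t * (s * x) + s * (t * y) by ring.
    by apply: idealD; [exact: principal_ideal|apply: ideal_mull..] => //;
      exact: principal_ideal.
  move=> a x [s Ts fx]; exists s => //; rewrite mulrCA.
  by apply: ideal_mull => //; exact: principal_ideal.
have multM : mult [set s | ~ M s].
  split=> // [s t Ms Mt|t Mt [c tE]]; first exact: prime_notM.
  by apply: Mt; rewrite tE; apply: ideal_mulr => //; exact: prime_is_ideal.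
have [_ [[T [mT ->]] Tmax]] :=
  @acc_max _ _ [set B | exists T, mult T /\ B = A T] (A [set s | ~ M s]) accM
    (fun _ '(ex_intro T (conj mT AE)) => eq_ind_r _ (A_sat T mT) AE)
    (ex_intro _ _ (conj multM erefl)).
have [MT TM Tf] := mT; have T1 : T 1 by apply: MT; exact: prime_proper.
have [iA _] := A_sat _ mT.
have nzd x : ~ (exists k, A T (x ^+ k)) -> forall y, A T (x * y) -> A T y.
  move=> nx y Axy; pose T' := [set u | exists t k, T t /\ u = t * x ^+ k].
  have TT' : T `<=` T' by move=> t Tt; exists t, 0%N; rewrite expr0 mulr1.
  have mT' : mult T'.
    split=> [s /MT/TT'//|_ _ [s [k [Ts ->]]] [t [l [Tt ->]]]|_ [t [k [Tt ->]]] ft].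
      by exists (s * t), (k + l)%N; split; [exact: TM|rewrite exprD; ring].
    by apply: nx; exists k, t.
  rewrite -(Tmax (A T')); first last.
  - by move=> z [t /TT' Tt fz]; exists t.
  - by exists T'.
  case: Axy => t Tt; rewrite mulrA => ft; exists (t * x) => //.
  by exists t, 1%N; rewrite expr1.
have A1 k : ~ A T (1 ^+ k) by rewrite expr1n => -[t /Tf]; rewrite mulr1.
exists [set x | exists k, A T (x ^+ k)]; split.
- apply: mkprime => [|[k /A1]//|x y [k]].
  + split; first by exists 1%N; rewrite expr1; exact: ideal0.
      move=> x y [k Ax] [l Ay]; exists (k + l)%N; rewrite exprDn.
      apply: ideal_sum => // i _; rewrite -mulr_natr; apply: ideal_mulr => //.
      have [li|il] := leqP l i.
        by apply: ideal_mull => //; rewrite -(subnK li) exprD; apply: ideal_mull.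
      apply: ideal_mulr => //; have -> : (k + l - i = k + (l - i))%N by lia.
      by rewrite exprD; apply: ideal_mulr.
    by move=> a x [k Ax]; exists k; rewrite exprMn; apply: ideal_mull.
  + move=> + nx; rewrite exprMn => Axy; exists k; move: (y ^+ k) Axy => z.
    elim: k => [|k IHk]; first by rewrite expr0 mul1r.
    by rewrite exprS -mulrA => /(nzd _ nx); apply: IHk.
- by exists 1%N, 1 => //; rewrite expr1 mul1r; exact: principal_id.
- move=> x [k Ax]; apply: contrapT => Mx; have {Ax} [t Tt] := Ax.
  apply: Tf; apply: TM => //; apply: MT => /(prime_X pM) //.
(* Elements of [T] lie outside the radical of [A T], as [T] is closed under products and misses
   [(f)]. *)
move=> m [k [t Tt ft]]; exists t, k; split=> // -[l [u Tu]].
suff : T (t ^+ l) by move=> /(TM _ _ Tu)/Tf.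
by elim: l {Tu} => [|l IHl]; rewrite ?expr0 // exprS; apply: TM.
Qed.

(* Noetherian induction on [K]: if [x] has annihilator [Q] modulo [K], then
   [(K + x R) / K] is locally simple, and the chain is stationary because it is so
   both modulo [K + x R] and after intersection with it. *)
Lemma dcc_over_principal Q g K (I : nat -> set R) : prime_ideal Q ->
  acc (saturated Q) -> Q g -> radical_of_principal Q g -> saturated Q K -> K g ->
  (forall n, saturated Q (I n)) -> (forall n, I n.+1 `<=` I n) ->
  (forall n, K `<=` I n) ->
  exists N, forall n, (N <= n)%N -> I N `<=` I n.
Proof.
move=> pQ accQ Qg radQ satK Kg satI Imon KI; apply: contrapT => bad.
pose chain K (I : nat -> set R) :=
  [/\ forall n, saturated Q (I n), forall n, I n.+1 `<=` I n & forall n, K `<=` I n].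
pose stable (I : nat -> set R) := exists N, forall n, (N <= n)%N -> I N `<=` I n.
pose F K := [/\ saturated Q K, K g & exists2 I, chain K I & ~ stable I].
have FK : F K by split=> //; exists I.
clear I bad satI Imon KI satK Kg; move: K FK => K0.
move=> /(acc_max accQ) []; first by move=> ? [].
move=> K [[satK Kg [I [satI Imon KI] bad]] Kmax]; clear K0.
have Imn m n : (m <= n)%N -> I n `<=` I m.
  move=> /subnK <-; elim: (n - m)%N => //= k IHk.
  exact: subset_trans (Imon _) IHk.
have iK : is_ideal K by case: satK.
have K1 : ~ K 1.
  move=> K1; apply: bad; exists 0%N => n _ x _; apply: KI.
  by rewrite (ideal_unit iK K1).
(* [x] realizes [Q] as an associated prime of [K]. *)
have [x Kx Qx] : exists2 x, ~ K x & colon K [set x] = Q.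
  have [||_ [[x [Kx ->]] xmax]] := @acc_max _ _
    [set L | exists x, ~ K x /\ L = colon K [set x]] (colon K [set 1]) accQ.
  - by move=> _ [x [_ ->]]; apply: colon_saturated.
  - by exists 1.
  exists x => //; have sC := @colon_saturated R Q K [set x] satK.
  have C1 : ~ colon K [set x] 1 by move=> /(_ x erefl); rewrite mul1r.
  have pC : prime_ideal (colon K [set x]).
    apply: mkprime => [|//|y z Cyz Cy]; first by case: sC.
    have Kyx : ~ K (y * x) by move=> Kyx; apply: Cy => _ ->.
    rewrite -(xmax (colon K [set y * x])).
    - by move=> _ ->; rewrite mulrCA mulrA; apply: Cyz.
    - by exists (y * x).
    - by move=> u Cu _ ->; rewrite mulrCA; apply: ideal_mull => //; apply: Cu.
  apply/seteqP; split; first exact: saturated_sub.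
  (* Up to a factor outside [Q], a power of [m] is a multiple of [g], and [g] lies in [K]. *)
  move=> m /radQ [s [k [Qs [c scE]]]].
  suff : colon K [set x] (m ^+ k) by move/(prime_X pC).
  case: sC => iC sC; refine (sC s _ Qs _).
  rewrite scE; refine (ideal_mulr c iC _) => _ ->; exact: ideal_mulr.
pose K' := saturation Q (add_principal K x).
have iKx := @add_principal_ideal R K x iK.
have satK' : saturated Q K' by apply: saturation_saturated.
have KK' : K `<=` K'.
  by apply: subset_trans (sub_saturation pQ); apply: sub_add_principal.
pose J n := saturation Q [set z | exists i k, [/\ I n i, K' k & z = i + k]].
have iIK n : is_ideal [set z | exists i k, [/\ I n i, K' k & z = i + k]].
  have [iI _] := satI n; have [iK' _] := satK'; split.
  - by exists 0, 0; rewrite addr0; split=> //; exact: ideal0.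
  - move=> _ _ [i [k [Ii Kk ->]]] [j [l [Ij Kl ->]]].
    by exists (i + j), (k + l); rewrite addrACA; split=> //; apply: idealD.
  move=> a _ [i [k [Ii Kk ->]]]; exists (a * i), (a * k).
  by rewrite mulrDr; split=> //; apply: ideal_mull.
have [n0 Jn0] : stable J.
  apply: contrapT => badJ; apply: (Kx); rewrite -(Kmax K').
  - by apply: sub_saturation => //; apply: add_principal_id.
  - split=> //; first exact: KK'.
    exists J => //; split=> [n|n|n].
    + by apply: saturation_saturated.
    + by apply: saturationS => _ [i [k [/Imon Ii Kk ->]]]; exists i, k.
    + move=> k Kk; apply: sub_saturation => //; exists 0, k; rewrite add0r.
      by split=> //; apply: ideal0; case: (satI n).
  - exact: KK'.
(* As [K' / K] is locally simple, the [I n] either meet [K'] inside [K] from some index on or all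
   contain [x]. *)
have [n1 In1] : exists n1, forall n, (n1 <= n)%N -> I n1 `&` K' `<=` I n.
  have [[n1 IKn1]|no] := EM (exists n1, I n1 `&` K' `<=` K).
    by exists n1 => n _; apply: subset_trans IKn1 (KI n).
  exists 0%N => n _ z [_ [s Qs [k [c [Kk szE]]]]].
  suff Ix : I n x.
    have [iI sI] := satI n; apply: (sI s) => //; rewrite szE.
    by apply: idealD => //; [exact: KI|apply: ideal_mulr].
  apply: contrapT => nIx; apply: no; exists n => y [Iy [t Qt [l [d [Kl tyE]]]]].
  case: (satK) => _ sK; apply: (sK t) => //; rewrite tyE.
  apply: idealD => //; have [Qd|Qd] := EM (Q d).
    by move: Qd; rewrite -Qx mulrC; apply.
  have [iI sI] := satI n; case: nIx; apply: (sI d) => //.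
  have -> : d * x = t * y - l by rewrite tyE; ring.
  by apply: idealB => //; [apply: ideal_mull|exact: KI].
apply: bad; exists (maxn n0 n1) => n le_n y Iy.
have Jy : J n y.
  apply: (Jn0 n _ y); first lia.
  apply: sub_saturation => //; exists y, 0; rewrite addr0; split=> //.
    by apply: Imn Iy; lia.
  by apply: ideal0; case: satK'.
have [s Qs [i [k [Ii Kk syE]]]] := Jy.
have [iI sI] := satI n; apply: (sI s) => //; rewrite syE; apply: idealD => //.
apply: (In1 n); [lia|split=> //].
have [iIm _] := satI (maxn n0 n1).
have -> : k = s * y - i by rewrite syE; ring.
apply: (Imn _ _ (leq_maxr n0 n1)).
by apply: idealB => //; [apply: ideal_mull|apply: Imn _ _ le_n _ Ii].
Qed.

(** Locally [A = B + g A]. For [C] maximal among the saturated ideals between [B] and [A] other than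
    [A], any [x] of [A] outside [C] generates [A] locally modulo [C], and then an element outside
    [Q] multiplies [x] into [C]. *)
Lemma nakayama Q A B g : prime_ideal Q -> acc (saturated Q) -> Q g ->
  saturated Q A -> saturated Q B -> B `<=` A ->
  (forall x, A x -> exists s b y, [/\ ~ Q s, B b, A y & s * x = b + g * y]) ->
  A `<=` B.
Proof.
move=> pQ accQ Qg satA satB BA Astep; apply: contrapT => nAB.
have [||C [[satC BC CA nAC] Cmax]] := @acc_max _ _
  [set C | [/\ saturated Q C, B `<=` C, C `<=` A & ~ A `<=` C]] B accQ.
- by move=> C [].
- by split.
apply: nAC => x Ax; apply: contrapT => nCx.
have [iC sC] := satC; have [iA sA] := satA.
pose C' := saturation Q (add_principal C x).
have iCx := @add_principal_ideal R C x iC.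
have AC' : A `<=` C'.
  apply: contrapT => nAC'; apply: nCx; rewrite -(Cmax C').
  - by apply: sub_saturation => //; apply: add_principal_id.
  - split=> //.
    + exact: saturation_saturated.
    + apply: subset_trans BC _; apply: subset_trans (sub_saturation pQ).
      exact: sub_add_principal.
    + move=> z [s Qs [c [d [Cc szE]]]]; apply: (sA s) => //; rewrite szE.
      by apply: idealD => //; [exact: CA|apply: ideal_mulr].
  - by apply: subset_trans (sub_saturation pQ); apply: sub_add_principal.
have [s [b [y [Qs Bb Ay sxE]]]] := Astep x Ax.
have [t Qt [c [r [Cc tyE]]]] := AC' y Ay.
apply: nCx; apply: (sC (t * s - g * r)).
  move=> Qd; apply: (prime_notM pQ Qt Qs).
  rewrite -[t * s](subrK (g * r)); have iQ := prime_is_ideal pQ.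
  by apply: idealD => //; apply: ideal_mulr.
have -> : (t * s - g * r) * x = t * b + g * c.
  have -> : (t * s - g * r) * x = t * (s * x) - g * (x * r) by ring.
  rewrite sxE; have -> : t * (b + g * y) = t * b + g * (t * y) by ring.
  by rewrite tyE; ring.
by apply: idealD => //; apply: ideal_mull => //; apply: BC.
Qed.

(* Krull's principal ideal theorem. For [0 != p] in [P], the chain of the ideals
   [p^n R : g^oo] descends; it is stationary modulo [g], hence stationary by
   Nakayama's lemma, so that some power of [g] is a multiple of [p]. *)
Lemma principal_ideal_theorem P Q g : prime_ideal Q -> acc (saturated Q) -> Q g ->
  radical_of_principal Q g -> prime_ideal P -> P `<=` Q -> P != [set 0] -> P = Q.
Proof.
move=> pQ accQ Qg radQ pP PQ P0; have iP := prime_is_ideal pP.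
have [p Pp p0] := nonzero_ideal iP P0.
suff Pg : P g.
  apply/seteqP; split=> // m /radQ [s [k [Qs [c smE]]]].
  apply: (@prime_X _ _ _ k pP); case: (pP) => _ _ /(_ s (m ^+ k)) [|/PQ//|//].
  by rewrite smE; apply: ideal_mulr.
pose I n : set R :=
  [set x | exists s k, ~ Q s /\ principal (p ^+ n) (s * g ^+ k * x)].
have satI n : saturated Q (I n).
  have ip := principal_ideal (p ^+ n); split; last first.
    move=> s x Qs [t [k [Qt H]]]; exists (t * s), k; split; first exact: prime_notM.
    by have -> : t * s * g ^+ k * x = t * g ^+ k * (s * x) by ring.
  split.
  - by exists 1, 0%N; split; [exact: prime_proper|rewrite mulr0; exact: ideal0].
  - move=> x y [s [k [Qs Hx]]] [t [l [Qt Hy]]]; exists (s * t), (k + l)%N.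
    split; first exact: prime_notM.
    have -> : s * t * g ^+ (k + l) * (x + y) =
        (t * g ^+ l) * (s * g ^+ k * x) + (s * g ^+ k) * (t * g ^+ l * y).
      by rewrite exprD; ring.
    by apply: idealD => //; apply: ideal_mull.
  - by move=> a x [s [k [Qs Hx]]]; exists s, k; split=> //; rewrite mulrCA; apply: ideal_mull.
have Idiv n x : I n (g * x) -> I n x.
  move=> [s [k [Qs H]]]; exists s, k.+1; split=> //.
  by have -> : s * g ^+ k.+1 * x = s * g ^+ k * (g * x) by rewrite exprS; ring.
have Imon n : I n.+1 `<=` I n.
  move=> x [s [k [Qs [c H]]]]; exists s, k; split=> //; exists (p * c).
  by rewrite H exprSr mulrA.
pose J n := saturation Q (add_principal (I n) g).
have iJ n : is_ideal (add_principal (I n) g).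
  by apply: add_principal_ideal; case: (satI n).
have [|||||N JN] := @dcc_over_principal Q g (saturation Q (principal g)) J pQ accQ Qg radQ.
- by apply: saturation_saturated => //; exact: principal_ideal.
- by apply: sub_saturation => //; exact: principal_id.
- by move=> n; apply: saturation_saturated.
- by move=> n; apply: saturationS => _ [y [c [/Imon Iy ->]]]; exists y, c.
- move=> n; apply: saturationS => _ [c ->]; exists 0, c; rewrite add0r; split=> //.
  by apply: ideal0; case: (satI n).
have IN : I N `<=` I N.+1.
  apply: (@nakayama Q _ _ g) => // x Ix.
  have [|s Qs [y [c [Iy sxE]]]] := JN N.+1 (leqnSn N) x.
    by apply: sub_saturation => //; apply: sub_add_principal.
  exists s, y, c; split=> //; apply: Idiv.
  have [iI _] := satI N; have -> : g * c = s * x - y by rewrite sxE; ring.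
  by apply: idealB => //; [apply: ideal_mull|apply: Imon].
have [|s [k [Qs [c H]]]] := IN (p ^+ N).
  exists 1, 0%N; split; first exact: prime_proper.
  by rewrite expr0 !mul1r; exact: principal_id.
have : s * g ^+ k = p * c.
  have pN0 : p ^+ N != 0 by rewrite expf_neq0.
  by apply: (mulfI pN0); rewrite mulrC H exprSr mulrA.
move=> sgE; apply: (@prime_X _ _ _ k pP); case: (pP) => _ _ /(_ s (g ^+ k)) [|/PQ//|//].
by rewrite sgE; apply: ideal_mulr.
Qed.

End PrincipalIdealTheorem.

(** * Hilbert's basis theorem *)

Section HilbertBasis.
Variables (R : idomainType) (Q : set R).
Hypothesis pQ : prime_ideal Q.

Let lead (I : set {poly R}) n : set R :=
  saturation Q [set c | exists p, [/\ I p, (size p <= n.+1)%N & p`_n = c]].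

Let lead_saturated I n : is_ideal I -> saturated Q (lead I n).
Proof.
move=> iI; apply: saturation_saturated => //; split.
- by exists 0; rewrite size_poly0 coef0; split=> //; exact: ideal0.
- move=> _ _ [p [Ip sp <-]] [q [Iq sq <-]]; exists (p + q); rewrite coefD; split=> //.
    exact: idealD.
  by rewrite (leq_trans (size_polyD _ _)) // geq_max sp.
- move=> a _ [p [Ip sp <-]]; exists (a *: p); rewrite coefZ; split=> //.
    by rewrite -mul_polyC; exact: ideal_mull.
  exact: leq_trans (size_scale_leq _ _) sp.
Qed.

Let leadS I J n : I `<=` J -> lead I n `<=` lead J n.
Proof. by move=> IJ; apply: saturationS => _ [p [/IJ Jp sp <-]]; exists p. Qed.

Let lead_mono I m n : is_ideal I -> (m <= n)%N -> lead I m `<=` lead I n.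
Proof.
move=> iI mn; apply: saturationS => _ [p [Ip sp <-]].
exists ('X^(n - m) * p); rewrite coefXnM ltnNge leq_subr /= subKn //.
split=> //; first exact: ideal_mull.
rewrite (leq_trans (size_polyMleq _ _)) // size_polyXn; move: sp; lia.
Qed.

(** Induction on the size: a multiple of [p] by some [s] outside [Q] has the leading coefficient of
    some [q] in [I], the difference is shorter, and saturation removes [s]. *)
Let lead_inj I J : saturated (poly_ext Q) I -> is_ideal J -> I `<=` J ->
  (forall n, lead J n `<=` lead I n) -> J `<=` I.
Proof.
move=> [iI sI] iJ IJ ledJI p; have iQ := prime_is_ideal pQ.
have [n] := ubnP (size p); elim: n p => // n IHn p ltpn Jp.
have [->|p0] := eqVneq p 0; first exact: ideal0.
have [|s Qs [q [Iq sq qE]]] := ledJI (size p).-1 (p`_(size p).-1).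
  by apply: sub_saturation => //; exists p; rewrite leqSpred.
have sp : (0 < size p)%N by rewrite size_poly_gt0.
have IC : I (s%:P * p - q).
  apply: IHn; last by apply: idealB => //; [exact: ideal_mull|exact: IJ].
  apply: (@leq_trans (size p).-1.+1); last by rewrite prednK.
  rewrite ltnS.
  apply/leq_sizeP => j; rewrite leq_eqVlt => /orP[/eqP <-|ltj].
    by rewrite coefB coefCM qE subrr.
  rewrite coefB coefCM !nth_default ?mulr0 ?subr0 //.
    exact: leq_trans sq ltj.
  by rewrite -(prednK sp).
apply: (sI s%:P); first by move=> /(poly_extC _ iQ).
by rewrite -[_ * p](subrK q); apply: idealD.
Qed.

(** The ideals [lead (I k) m] grow with [k] and [m]. The diagonal is stationary from some [N] on,
    which settles the degrees [m >= N]; the finitely many smaller degrees are treated one by one. *)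
Lemma acc_poly_ext : acc (saturated Q) -> acc (saturated (poly_ext Q)).
Proof.
move=> accQ I satI Imon; have Imn := chain_mono Imon.
have iI n : is_ideal (I n) by case: (satI n).
have lead_acc (f g : nat -> nat) :
    (forall n, f n <= f n.+1)%N -> (forall n, g n <= g n.+1)%N ->
    exists N, forall n, (N <= n)%N -> lead (I (f n)) (g n) = lead (I (f N)) (g N).
  move=> fS gS; apply: (accQ (fun n => lead (I (f n)) (g n))) => n.
    exact: lead_saturated.
  apply: subset_trans (lead_mono (iI _) (gS n)) _.
  by apply: leadS; apply: Imn.
have [N diagN] := lead_acc id id (fun n => leqnSn n) (fun n => leqnSn n).
have [K rowK] : exists K, forall m, (m < N)%N -> forall k, (K <= k)%N ->
    lead (I k) m = lead (I K) m.
  elim: N {diagN} => [|N [K rowK]]; first by exists 0%N.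
  have [L colL] := lead_acc id (fun=> N) (fun n => leqnSn n) (fun n => leqnn N).
  exists (maxn K L) => m; rewrite ltnS leq_eqVlt => /orP[/eqP ->|ltm] k lek.
    by rewrite colL 1?[RHS]colL //; lia.
  by rewrite rowK 1?[RHS]rowK //; lia.
exists (maxn N K) => n len; apply/seteqP; split; last exact: Imn.
apply: lead_inj => //; first exact: Imn.
move=> m; have [ltm|lem] := ltnP m N.
  by rewrite rowK // 1?[X in _ `<=` X]rowK //; lia.
apply: (@subset_trans _ (lead (I N) N)).
  rewrite -(diagN (maxn m n)); last lia.
  apply: subset_trans (lead_mono (iI _) (leq_maxl m n)) _.
  by apply: leadS; apply: Imn; lia.
apply: subset_trans (lead_mono (iI _) lem) _.
by apply: leadS; apply: Imn; lia.
Qed.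

End HilbertBasis.

(** * w-ideals *)

Section WIdealTheory.
Variable R : idomainType.
Implicit Types I J K M N P Q : set R.

Lemma frac_num_den (a : {fraction R}) :
  exists n d : R, d != 0 /\ a = tofrac n / tofrac d.
Proof.
elim/quotW: a => x; exists \n_x, \d_x; split; first exact: denom_ratioP.
have d0 : tofrac \d_x != 0 by rewrite tofrac_eq0 denom_ratioP.
apply: (mulIf d0); rewrite divfK //; unlock FracField.tofrac.
rewrite -[LHS]FracField.pi_mul; apply/eqmodP/eqP => /=.
rewrite /FracField.mulf /= !numden_Ratio ?oner_neq0 ?mulf_neq0 ?denom_ratioP ?mulr1 //=.
all: by rewrite ?oner_neq0 // mulrC.
Qed.

Lemma in_fracE I x : in_frac I (tofrac x) <-> I x.
Proof.
split=> [[y Iy /eqP]|Ix]; last by exists x.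
by rewrite tofrac_eq => /eqP <-.
Qed.

(** Clearing denominators: [a / b] maps [J] into [R] when [b] divides [a J], and lies in [R] when
    [b] divides [a]. *)
Lemma GV_idealP J : GV_ideal J <-> [/\ J != [set 0], fin_gen_ideal J &
  forall a b, b != 0 -> (forall x, J x -> principal b (a * x)) -> principal b a].
Proof.
have frac_mul (a b c x : R) : b != 0 ->
    (tofrac a / tofrac b * tofrac x = tofrac c <-> a * x = b * c).
  move=> b0; have b0' : tofrac b != 0 by rewrite tofrac_eq0.
  rewrite mulrAC -tofracM; split=> [/(canRL (divfK b0'))|->].
    by rewrite -tofracM mulrC => /eqP; rewrite tofrac_eq mulrC (mulrC c) => /eqP.
  by rewrite tofracM mulrAC mulfV // mul1r.
split=> -[J0 Jfg JV]; split=> //.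
  move=> a b b0 aJ; have : in_frac setT (tofrac a / tofrac b).
    rewrite -JV => _ [x Jx <-]; have [c cE] := aJ x Jx.
    by exists c => //; apply/esym/(frac_mul a b c x b0).
  case=> c _ cE; exists c; rewrite -[a]mulr1; apply/(frac_mul a b c 1 b0).
  by rewrite tofrac1 mulr1.
apply/seteqP; split=> [u uJ|_ [c _ <-] _ [x Jx <-]].
  have [a [b [b0 uE]]] := frac_num_den u.
  have [x Jx|c aE] := JV a b b0.
    have [|c _ cE] := uJ (tofrac x); first by apply/in_fracE.
    by exists c; apply/(frac_mul a b c x b0); rewrite -uE.
  exists c => //; rewrite uE; have := frac_mul a b c 1 b0.
  by rewrite tofrac1 !mulr1 => /iffRL ->.
by exists (c * x) => //; rewrite tofracM.
Qed.

Definition span (s : seq R) : set R :=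
  [set x | exists c : 'I_(size s) -> R, x = \sum_(i < size s) c i * s`_i].

Lemma mem_span s x : x \in s -> span s x.
Proof.
move=> /(nthP 0) [i lti <-]; exists (fun j => (j == Ordinal lti)%:R).
rewrite (bigD1 (Ordinal lti)) //= eqxx mul1r big1 ?addr0 // => j /negPf ->.
by rewrite mul0r.
Qed.

Lemma span_sub s I : is_ideal I -> (forall x, x \in s -> I x) -> span s `<=` I.
Proof.
move=> iI sI _ [c ->]; apply: ideal_sum => // i _; apply: ideal_mull => //.
by apply: sI; apply: mem_nth.
Qed.

Lemma GV_span s : (exists2 x, x \in s & x != 0) ->
  (forall a b, b != 0 -> (forall x, x \in s -> principal b (a * x)) -> principal b a) ->
  GV_ideal (span s).
Proof.
move=> [x xs x0] sV; apply/GV_idealP; split; first exact: ideal_nonzero (mem_span xs) x0.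
  by exists (size s), (fun i => s`_i).
by move=> a b b0 aV; apply: sV => // y /mem_span; apply: aV.
Qed.

(** A fraction that multiplies a GV-ideal [J] into [I] lies in the inverse of [J], which is [R]; so
    testing elements of [R] suffices. *)
Lemma w_idealP I : w_ideal I <-> [/\ is_ideal I, I != [set 0] &
  forall J x, GV_ideal J -> (forall y, J y -> I (x * y)) -> I x].
Proof.
split=> -[iI I0 Iw]; split=> //.
  move=> J x GVJ xJ; apply/in_fracE; rewrite -Iw; exists J => //.
  by move=> _ [y Jy <-]; rewrite -tofracM; apply/in_fracE; apply: xJ.
apply/seteqP; split=> [u [J GVJ uJ]|_ [x Ix <-]].
  have [_ _ JV] := GVJ.
  have : in_frac setT u by rewrite -JV => x /uJ [y _ <-]; exists y.
  case=> x _ xE; rewrite -xE; apply/in_fracE; apply: (Iw J) => // y Jy.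
  by apply/in_fracE; rewrite tofracM xE; apply: uJ; apply/in_fracE.
exists (span [:: 1]).
  apply: GV_span => [|a b _ /(_ 1)]; first by exists 1; rewrite ?inE ?oner_eq0.
  by rewrite mulr1; apply; rewrite inE.
by move=> _ [y _ <-]; rewrite -tofracM; apply/in_fracE; apply: ideal_mulr.
Qed.

Lemma w_is_ideal I : w_ideal I -> is_ideal I. Proof. by case. Qed.

Lemma w_idealW I J x : w_ideal I -> GV_ideal J -> (forall y, J y -> I (x * y)) -> I x.
Proof. by move=> /w_idealP [_ _]; apply. Qed.

Lemma w_no_GV I J : w_ideal I -> ~ I 1 -> GV_ideal J -> ~ J `<=` I.
Proof.
by move=> wI I1 GVJ JI; apply/I1/(w_idealW wI GVJ) => y /JI; rewrite mul1r.
Qed.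

Lemma GV_principal J a b : GV_ideal J -> b != 0 ->
  (forall x, J x -> principal b (a * x)) -> principal b a.
Proof. by move=> /GV_idealP [_ _]; apply. Qed.

Lemma prime_w P I : prime_ideal P -> P != [set 0] -> P `<=` I -> w_ideal I -> ~ I 1 ->
  w_ideal P.
Proof.
move=> pP P0 PI wI I1; apply/w_idealP; split=> // [|J x GVJ xJ].
  exact: prime_is_ideal.
apply: contrapT => Px; apply: (w_no_GV wI I1 GVJ) => y /xJ.
by case: (pP) => _ _ /[apply] -[//|/PI].
Qed.

Lemma w_principal (d : R) : d != 0 -> w_ideal (principal d).
Proof.
move=> d0; apply/w_idealP; split; first exact: principal_ideal.
  exact: ideal_nonzero (principal_id d) d0.
by move=> J x GVJ; apply: GV_principal.
Qed.

Lemma w_colon I K : w_ideal I -> w_ideal (colon I K).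
Proof.
move=> wI; have iI := w_is_ideal wI; have [_ I0 _] := wI.
have [x Ix x0] := nonzero_ideal iI I0.
apply/w_idealP; split; [exact: colon_ideal| |].
  by apply: ideal_nonzero x0; apply: sub_colon.
move=> J y GVJ yJ k Kk; apply: (w_idealW wI GVJ) => z Jz.
by rewrite mulrAC; apply: yJ.
Qed.

Lemma w_bigcap (F : set (set R)) (d : R) : d != 0 ->
  (forall I, F I -> w_ideal I /\ I d) -> w_ideal (\bigcap_(I in F) I).
Proof.
move=> d0 wF; apply/w_idealP; split.
- split=> [I /wF [[iI _ _] _]|x y Fx Fy I FI|a x Fx I FI]; first exact: ideal0.
    by have [[iI _ _] _] := wF _ FI; apply: idealD; [|exact: Fx|exact: Fy].
  by have [[iI _ _] _] := wF _ FI; apply: ideal_mull => //; exact: Fx.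
- by apply: ideal_nonzero d0 => I /wF [].
- move=> J x GVJ xJ I FI; have [wI _] := wF _ FI.
  by apply: (w_idealW wI GVJ) => y /xJ; apply.
Qed.

Lemma max_w_eq M N : maximal_w_ideal M -> w_ideal N -> ~ N 1 -> M `<=` N -> N = M.
Proof.
move=> [_ _ Mmax] wN N1 MN; apply: contrapT => NM; apply: Mmax; exists N; split=> //.
  by apply/eqP => NT; apply: N1; rewrite NT.
by split=> // NsubM; apply: NM; apply/seteqP.
Qed.

Lemma mk_max_w M : w_ideal M -> ~ M 1 ->
  (forall N, w_ideal N -> ~ N 1 -> M `<=` N -> N `<=` M) -> maximal_w_ideal M.
Proof.
move=> wM M1 Mmax; split=> // [|[N [wN NT [MN]]]].
  by apply/eqP => MT; apply: M1; rewrite MT.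
by apply; apply: Mmax => //; apply: ideal_proper => //; exact: w_is_ideal.
Qed.

Lemma max_w_proper M : maximal_w_ideal M -> ~ M 1.
Proof. by case=> -[iM _ _] MT _; apply: ideal_proper. Qed.

(** For [y] outside [M], [(M : y)] is a proper w-ideal containing [M], hence equal to [M]. *)
Lemma max_w_prime M : maximal_w_ideal M -> prime_ideal M.
Proof.
move=> maxM; have M1 := max_w_proper maxM; have [wM _ _] := maxM.
have iM := w_is_ideal wM; apply: mkprime => // x y Mxy Mx; apply: contrapT => My.
have wC : w_ideal (colon M [set y]) by exact: w_colon.
apply: Mx; rewrite -(max_w_eq maxM wC).
- by move=> _ ->.
- by move=> /(_ y erefl); rewrite mul1r.
- exact: sub_colon.
Qed.

Hypothesis accw : acc (@w_ideal R).

Lemma max_w_exists I : w_ideal I -> ~ I 1 -> exists2 M, maximal_w_ideal M & I `<=` M.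
Proof.
move=> wI I1; have [||M [[wM M1 IM] Mmax]] := @acc_max _ _
  [set M | [/\ w_ideal M, ~ M 1 & I `<=` M]] I accw.
- by move=> M [].
- by split.
exists M => //; apply: mk_max_w => // N wN N1 MN.
by rewrite (Mmax N) //; split=> //; apply: subset_trans MN.
Qed.

(** A GV-ideal is never inside [Q], so it has an element that saturation can cancel: nonzero
    saturated ideals are w-ideals. The chain is read from its first known nonzero term. *)
Lemma acc_saturated_w Q : prime_ideal Q -> w_ideal Q -> acc (saturated Q).
Proof.
move=> pQ wQ I satI Imon; have Q1 := prime_proper pQ.
have Imn := chain_mono Imon.
have [[n0 I0]|I0] := EM (exists n, I n != [set 0]); last first.
  have IE n : I n = [set 0] by apply: contrapT => /eqP H; apply: I0; exists n.
  by exists 0%N => n _; rewrite !IE.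
have [x Ix x0] : exists2 x, I n0 x & x != 0 by apply: nonzero_ideal => //; case: (satI n0).
have [n|n|N IN] := accw (I := fun n => I (n + n0)%N).
- have [iI sI] := satI (n + n0)%N; apply/w_idealP; split=> // [|J y GVJ yJ].
    by apply: ideal_nonzero x0; apply: (Imn _ _ (leq_addl n n0)).
  apply: contrapT => Iy; apply: (w_no_GV wQ Q1 GVJ) => z Jz; apply: contrapT => Qz.
  by apply: Iy; apply: (sI z) => //; rewrite mulrC; apply: yJ.
- exact: Imon.
exists (N + n0)%N => n len; rewrite -(IN (n - n0)%N); last lia.
by congr I; lia.
Qed.

(* [I] is the w-ideal generated by finitely many elements; these do not generate
   a GV-ideal, and [b / d] witnesses it. *)
Lemma w_sub_fraction_colon I : w_ideal I -> ~ I 1 ->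
  exists b d, [/\ d != 0, ~ principal d b & forall x, I x -> principal d (x * b)].
Proof.
move=> wI I1; have [iI I0 _] := wI; have [m Im m0] := nonzero_ideal iI I0.
pose A (s : seq R) := \bigcap_(K in [set K | w_ideal K /\ forall x, x \in m :: s -> K x]) K.
have wA s : w_ideal (A s).
  by apply: (w_bigcap m0) => K [wK sK]; split=> //; apply: sK; rewrite inE eqxx.
have [||_ [[s [sI ->]] smax]] := @acc_max _ _
  [set B | exists s, (forall x, x \in s -> I x) /\ B = A s] (A [::]) accw.
- by move=> _ [s [_ ->]].
- by exists [::].
have IA : I `<=` A s.
  move=> x Ix; rewrite -(smax (A (x :: s))).
  - by move=> K [_]; apply; rewrite !inE eqxx orbT.
  - exists (x :: s); split=> // y; rewrite inE => /orP[/eqP -> //|]; exact: sI.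
  - move=> y sy K [wK sK]; apply: sy; split=> // z; rewrite inE => zs.
    by apply: sK; rewrite !inE; case/orP: zs => ->; rewrite ?orbT.
have AI : A s `<=` I.
  by move=> x /(_ I); apply; split=> // y; rewrite inE => /orP[/eqP -> //|]; exact: sI.
have notGV : ~ GV_ideal (span (m :: s)).
  move=> /(w_no_GV (wA s)); apply; first by move=> /AI.
  apply: span_sub; first exact: w_is_ideal.
  by move=> x xs K [_]; apply.
apply: contrapT => no; apply: notGV; apply: GV_span; first by exists m; rewrite ?inE ?eqxx.
move=> b d d0 bs; apply: contrapT => db; apply: no; exists b, d; split=> // x /IA.
move=> /(_ (colon (principal d) [set b])) H; apply: (H _ b erefl); split.
  by apply: w_colon; exact: w_principal.
by move=> y ys _ ->; rewrite mulrC; apply: bs.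
Qed.

(** By maximality [M = (d R : b)]; writing [a b = d c] turns the fraction [b / d] into [c / a], with
    the prescribed denominator. *)
Lemma max_w_colon M a : maximal_w_ideal M -> M a -> a != 0 ->
  exists c, M = colon (principal a) [set c].
Proof.
move=> maxM Ma a0; have M1 := max_w_proper maxM; have [wM _ _] := maxM.
have [b [d [d0 db Mb]]] := w_sub_fraction_colon wM M1.
have <- : colon (principal d) [set b] = M.
  apply: max_w_eq => //; first by apply: w_colon; exact: w_principal.
    by move=> /(_ b erefl); rewrite mul1r.
  by move=> x /Mb dxb _ ->.
have [c abE] := Mb a Ma; exists c; apply/seteqP; split=> x xM _ ->.
  have [e eE] := xM _ erefl; exists e; apply: (mulfI d0).
  have -> : d * (x * c) = x * (d * c) by ring.
  by rewrite -abE mulrCA eE; ring.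
have [e eE] := xM _ erefl; exists e; apply: (mulfI a0).
have -> : a * (x * b) = x * (a * b) by ring.
by rewrite abE mulrCA eE; ring.
Qed.

End WIdealTheory.

(** * From UMT to w-Hilbert *)

Section PolynomialExtension.
Variable D : idomainType.
Implicit Types I J K M N P Q : set D.

Hypothesis accw : acc (@w_ideal D).

Lemma poly_ext_nonzero P : P != [set 0] -> is_ideal P -> poly_ext P != [set 0].
Proof.
move=> P0 iP; have [x Px x0] := nonzero_ideal iP P0.
by apply: (@ideal_nonzero _ _ x%:P); [apply/poly_extC|rewrite polyC_eq0].
Qed.

(** Here [d] divides [b P] but not [b]. A GV-ideal [J] inside [P[X]] would make [d] divide [b J],
    hence [b]. *)
Lemma poly_ext_w P : prime_ideal P -> w_ideal P -> w_ideal (poly_ext P).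
Proof.
move=> pP wP; have [iP P0 _] := wP; have P1 := prime_proper pP.
have [b [d [d0 db Pb]]] := w_sub_fraction_colon accw wP P1.
have pPX := poly_ext_prime pP.
apply/w_idealP; split; [exact: poly_ext_ideal|exact: poly_ext_nonzero|].
move=> J p GVJ pJ; apply: contrapT => nPp; apply: db.
have [q qE] : principal d%:P b%:P.
  apply: (GV_principal GVJ); first by rewrite polyC_eq0.
  move=> f /pJ; case: (pPX) => _ _ /[apply] -[//|Pf].
  have [q qE] := choice (fun i => Pb _ (Pf i)).
  exists (\poly_(i < size f) q i); apply/polyP => i; rewrite !coefCM coef_poly.
  case: ltnP => [_|szf]; first by rewrite mulrC qE.
  by rewrite nth_default // !mulr0.
by exists q`_0; rewrite -coefCM -qE coefC.
Qed.

Definition contract (N : set {poly D}) : set D := [set d | N d%:P].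

Lemma contract_prime (N : set {poly D}) : prime_ideal N -> prime_ideal (contract N).
Proof.
move=> pN; have iN := prime_is_ideal pN; apply: mkprime.
- split=> [|x y|a x]; rewrite /contract /= ?polyC0; first exact: ideal0.
    by rewrite polyCD; apply: idealD.
  by rewrite polyCM; apply: ideal_mull.
- exact: prime_proper pN.
move=> x y; rewrite /contract /= polyCM; case: (pN) => _ _ /[apply] -[]//.
Qed.

(* Take [f] in [M[X]] such that the saturation of its content ideal is maximal. *)
Lemma content_generator M : prime_ideal M -> acc (saturated M) ->
  exists2 f, poly_ext M f & forall P, prime_ideal P -> poly_ext P f -> P `<=` M -> M `<=` P.
Proof.
move=> pM accM; have iM := prime_is_ideal pM.
pose A (f : {poly D}) : set D := \bigcap_(I in [set I | saturated M I /\ poly_ext I f]) I.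
have [||_ [[f [Mf ->]] fmax]] := @acc_max _ _
  [set B | exists f, poly_ext M f /\ B = A f] (A 0) accM.
- move=> _ [f [_ ->]]; split; last first.
    by move=> s x Ms Asx I [satI fI]; case: (satI) => _ sI; apply: (sI s) => //; apply: Asx.
  split=> [I [[iI _] _]|x y Ax Ay I H|a x Ax I H]; first exact: ideal0.
    by case: (H) => -[iI _] _; apply: idealD; [|exact: Ax|exact: Ay].
  by case: (H) => -[iI _] _; apply: ideal_mull => //; exact: Ax.
- by exists 0; split=> // i; rewrite coef0; exact: ideal0.
exists f => // P pP Pf PM m Mm.
suff : A f m by apply; split=> //; apply: prime_saturated.
(* By maximality, appending [m] as a further coefficient does not change [A f]. *)
rewrite -(fmax (A (f + 'X^(size f) * m%:P))).
- by move=> I [[iI _] /(poly_ext_add iI) [_ /(poly_extC _ iI)]].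
- exists (f + 'X^(size f) * m%:P); split=> //; have iMX := poly_ext_ideal iM.
  by refine (idealD iMX Mf (ideal_mull _ iMX _)); apply/poly_extC.
- by move=> x Ax I [[iI sI] /(poly_ext_add iI) [If _]]; apply: Ax.
Qed.

Lemma prime_height1 M P : prime_ideal M -> w_ideal M -> UMT_domain D ->
  prime_ideal P -> P != [set 0] -> P `<=` M -> M `<=` P.
Proof.
move=> pM wM umt pP P0 PM; have accM := acc_saturated_w accw pM wM.
have [iM M0 _] := wM; have iP := prime_is_ideal pP.
have [f Mf fgen] := content_generator pM accM.
have pMX := poly_ext_prime pM; have accMX := acc_poly_ext pM accM.
have [q [pq qf qM radq]] := prime_over_principal pMX accMX Mf.
have iq := prime_is_ideal pq; have pC := contract_prime pq; have iC := prime_is_ideal pC.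
have CM : contract q `<=` M by move=> d /qM /(poly_extC _ iM).
have height1 := principal_ideal_theorem pq (acc_saturatedS qM accMX) qf radq.
(* If [q] meets [D], height one makes [q] the extension of its contraction, which then contains [M];
   so [P[X]] lies in [q] and equals it too. *)
have [C0|/eqP C0] := EM (contract q = [set 0]); last first.
  have qE : poly_ext (contract q) = q.
    apply: height1; [exact: poly_ext_prime| |exact: poly_ext_nonzero].
    exact: poly_ext_sub.
  have MC : M `<=` contract q by apply: fgen => //; rewrite qE.
  have PqE : poly_ext P = q.
    apply: height1; [exact: poly_ext_prime| |exact: poly_ext_nonzero].
    by move=> p Pp; rewrite -qE => i; apply/MC/PM.
  by move=> x /MC; rewrite /contract /= -PqE => /(poly_extC _ iP).
have [x Mx x0] := nonzero_ideal iM M0.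
have f0 : f != 0.
  apply/eqP => f0; have /(fgen _ pC)/(_ CM)/(_ x Mx) : poly_ext (contract q) f.
    by rewrite f0 => i; rewrite coef0; exact: ideal0.
  by rewrite C0 => /eqP; apply/negP.
(* Otherwise [q] is an upper to zero; by maximality it equals [M[X]], which contains nonzero
   constants. *)
have maxq : maximal_w_ideal q by apply: umt; split=> //; exact: ideal_nonzero f0.
have qE := max_w_eq maxq (poly_ext_w pM wM) (prime_proper pMX) qM.
have : contract q x by rewrite /contract /= -qE; apply/poly_extC.
by rewrite C0 => /eqP; rewrite (negPf x0).
Qed.

Lemma UMT_w_Hilbert : UMT_domain D -> w_Hilbert_domain D.
Proof.
move=> umt P [pP wP]; exists [set P]; last by rewrite bigcap_set1.
move=> _ ->; apply: mk_max_w => //; first exact: prime_proper.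
move=> N wN N1 PN; have [M maxM NM] := max_w_exists accw wN N1.
apply: (subset_trans NM); have [wM _ _] := maxM; have [_ P0 _] := wP.
apply: prime_height1 => //; first exact: max_w_prime.
exact: subset_trans PN NM.
Qed.

(** * From w-Hilbert to UMT *)

(* Choose [I] maximal among the w-ideals containing [a D] that some element outside
   [P] multiplies into [a D]. If no [M = (a D : c)] in the family [S] with
   intersection [P] were contained in [P], then [(I : M) = I] would contain [c] for
   all of them. *)
Lemma w_Hilbert_maximal P : w_Hilbert_domain D -> prime_w_ideal P -> maximal_w_ideal P.
Proof.
move=> hilb primeP; have [pP wP] := primeP; have [iP P0 _] := wP.
have [S maxS PS] := hilb P primeP.
have [a Pa a0] := nonzero_ideal iP P0.
have [[M [SM MP]]|noM] := EM (exists M, S M /\ M `<=` P).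
  suff -> : P = M by apply: maxS.
  by apply/seteqP; split=> // x; rewrite PS; apply.
have [||I [[wI aI [p [Pp pI]]] Imax]] := @acc_max _ _
  [set I | [/\ w_ideal I, principal a `<=` I &
    exists p, ~ P p /\ forall x, I x -> principal a (p * x)]]
  (principal a) accw.
- by move=> I [].
- split=> //; first exact: w_principal.
  by exists 1; split=> [|x]; [exact: prime_proper|rewrite mul1r].
(* The contradiction will be that [p] lies in every [M] of [S]. *)
case: (Pp); rewrite PS => M SM; have maxM := maxS _ SM.
have [m Mm Pm] : exists2 m, M m & ~ P m.
  apply: contrapT => no; apply: noM; exists M; split=> // m Mm.
  by apply: contrapT => Pm; apply: no; exists m.
have Ma : M a by move: Pa; rewrite PS; apply.
have [c cE] := max_w_colon accw maxM Ma a0.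
(* [(I : M)] is again in the family, with [p * m] in place of [p], so it equals [I]. *)
have cI : I c.
  rewrite -(Imax (colon I M)); first last.
  - exact: sub_colon (w_is_ideal wI).
  - have IC : I `<=` colon I M by exact: sub_colon (w_is_ideal wI).
    split; [exact: w_colon|exact: (subset_trans aI IC)|].
    exists (p * m); split=> [|x Ix]; first exact: prime_notM.
    by rewrite -mulrA (mulrC m); apply: pI; apply: Ix.
  by move=> k; rewrite cE mulrC => /(_ c erefl); apply: aI.
by rewrite cE => _ ->; apply: pI.
Qed.

End PolynomialExtension.

(** * Uppers to zero as maximal w-ideals *)

Section UppersToZero.
Variable D : idomainType.
Implicit Types (P Q : set D) (q N : set {poly D}).

Lemma upper_contract0 q (d : D) : upper_to_zero q -> q d%:P -> d = 0.
Proof. by case=> _ _ qD qd; have : [set d : D | q d%:P] d by []; rewrite qD. Qed.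

(** Pseudo-division by an element [f] of least degree: [f] generates [N] over the quotient field,
    and [c] is the denominator. *)
Lemma minimal_degree_generator N : is_ideal N -> N != [set 0] ->
  (forall d : D, N d%:P -> d = 0) ->
  exists f, [/\ N f, (1 < size f)%N &
    forall g, N g -> exists c h, c != 0 /\ c%:P * g = f * h].
Proof.
move=> iN N0 ND; have [f0 Nf0 f00] := nonzero_ideal iN N0.
pose p n := `[< exists f, [/\ N f, f != 0 & size f = n] >].
have [|n /asboolP [f [Nf fn0 <-]] fmin] := @ex_minnP p.
  by exists (size f0); apply/asboolP; exists f0.
exists f; split=> // [|g Ng].
  rewrite ltnNge; apply/negP => /size1_polyC fE.
  by move: Nf fn0; rewrite fE => /ND ->; rewrite eqxx.
have divE := Pdiv.Idomain.divp_eq g f.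
exists (lead_coef f ^+ scalp g f), (g %/ f)%R.
split; first exact: Pdiv.Idomain.lc_expn_scalp_neq0.
have Nr : N (g %% f).
  have -> : g %% f = (lead_coef f ^+ scalp g f)%:P * g - f * (g %/ f).
    by rewrite mul_polyC divE; ring.
  by apply: idealB => //; [exact: ideal_mull|exact: ideal_mulr].
rewrite mul_polyC divE; suff -> : g %% f = 0 by rewrite addr0 mulrC.
apply: contrapT => /eqP r0.
have : (size f <= size (g %% f)%R)%N by apply: fmin; apply/asboolP; exists (g %% f).
by rewrite leqNgt ltn_modp fn0.
Qed.

(** If a GV-ideal lay in [q], a common denominator [d] of its generators would multiply it into
    [(f)]; then [f] would divide the nonzero constant [d], against its degree. *)
Lemma upper_w q : upper_to_zero q -> w_ideal q.
Proof.
move=> uq; have [pq q0 _] := uq; have iq := prime_is_ideal pq.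
have [f [qf szf fdiv]] := minimal_degree_generator iq q0 (fun d => @upper_contract0 q d uq).
apply/w_idealP; split=> // J p GVJ pJ; apply: contrapT => nqp.
have Jq : J `<=` q by move=> x /pJ; case: (pq) => _ _ /[apply] -[].
have [_ [n [g JE]] _] := GVJ.
have Jg i : J (g i).
  rewrite JE; exists (fun j => (j == i)%:R); rewrite (bigD1 i) //= eqxx mul1r.
  by rewrite big1 ?addr0 // => j /negPf ->; rewrite mul0r.
have [c cP] := choice (fun i => fdiv _ (Jq _ (Jg i))).
pose d := \prod_i c i.
have d0 : d != 0 by apply/prodf_neq0 => i _; have [h []] := cP i.
have fn0 : f != 0 by rewrite -size_poly_gt0 (ltn_trans _ szf).
have [|e dE] := GV_principal (a := d%:P) GVJ fn0.
  move=> x; rewrite JE => -[a ->]; rewrite mulr_sumr.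
  apply: ideal_sum => [|i _]; first exact: principal_ideal.
  have [h [_ hE]] := cP i; exists (h * (\prod_(j | j != i) c j)%:P * a i).
  rewrite /d (bigD1 i) //= polyCM.
  have -> : f * (h * (\prod_(j | j != i) c j)%:P * a i) =
    (f * h) * ((\prod_(j | j != i) c j)%:P * a i) by ring.
  by rewrite -hE; ring.
have e0 : e != 0 by apply: contraNneq d0 => e0; rewrite -polyC_eq0 dE e0 mulr0.
have := size_mul fn0 e0; rewrite -dE size_polyC d0 /=.
move: e0 szf; rewrite -size_poly_gt0.
by case: (size f) (size e) => [|[|?]] [|?] //; rewrite addnS addSn addSn.
Qed.

(** Otherwise [q] and [N] are generated over the quotient field by some [f] and [h], with
    [c f = h k]. As [q] is prime, either [h] is in [q] and [N] is inside [q], or [k] is in [q] and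
    [h] divides a nonzero constant. *)
Lemma above_upper_meets_base q N : upper_to_zero q -> is_ideal N -> q `<=` N ->
  ~ N `<=` q -> exists2 d : D, d != 0 & N d%:P.
Proof.
move=> uq iN qN nNq; have [pq q0 _] := uq; have iq := prime_is_ideal pq.
apply: contrapT => noD.
have ND (d : D) : N d%:P -> d = 0.
  by move=> Nd; apply: contrapT => /eqP d0; apply: noD; exists d.
have [f [qf szf fdiv]] := minimal_degree_generator iq q0 (fun d => @upper_contract0 q d uq).
have fn0 : f != 0 by rewrite -size_poly_gt0 (ltn_trans _ szf).
have N0 : N != [set 0] by apply: ideal_nonzero fn0; apply: qN.
have [h [Nh szh hdiv]] := minimal_degree_generator iN N0 ND.
have [c [k [c0 fE]]] := hdiv f (qN _ qf).
have : q (h * k) by rewrite -fE; apply: ideal_mull.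
case: (pq) => _ _ /[apply] -[qh|qk].
  apply: nNq => g /hdiv [e [l [e0 gE]]].
  have : q (e%:P * g) by rewrite gE; apply: ideal_mulr.
  case: (pq) => _ _ /[apply] -[/(upper_contract0 uq) eE|//].
  by rewrite eE eqxx in e0.
have [e [l [e0 kE]]] := fdiv k qk.
have ecE : (e * c)%:P = h * l.
  apply: (mulfI fn0); rewrite polyCM.
  have -> : f * (e%:P * c%:P) = e%:P * (c%:P * f) by ring.
  by rewrite fE mulrCA kE; ring.
have ec0 : e * c != 0 by rewrite mulf_neq0.
have hl0 : h * l != 0 by rewrite -ecE polyC_eq0.
move: hl0; rewrite mulf_eq0 negb_or => /andP[h0 l0].
have := size_mul h0 l0; rewrite -ecE size_polyC ec0 /=.
move: l0 szh; rewrite -size_poly_gt0.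
by case: (size h) (size l) => [|[|?]] [|?] //; rewrite addnS addSn addSn.
Qed.

Hypothesis accw : acc (@w_ideal D).
Hypothesis prime_w_max : forall P, prime_w_ideal P -> maximal_w_ideal P.

(** A prime [q'] minimal over a constant [a] of [Q] contracts to a prime w-ideal, which is maximal
    and hence [Q]; so [q'] is [Q[X]]. By the principal ideal theorem [q = q'], but [q] has no
    nonzero constant. *)
Lemma upper_not_extended q Q : upper_to_zero q -> prime_w_ideal Q ->
  ~ q `<=` poly_ext Q.
Proof.
move=> uq [pQ wQ] qQ; have [iQ Q0 _] := wQ; have [pq q0 _] := uq.
have [a Qa a0] := nonzero_ideal iQ Q0.
have accX := acc_poly_ext pQ (acc_saturated_w accw pQ wQ).
have aQ : poly_ext Q a%:P by apply/poly_extC.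
have [q' [pq' q'a q'Q radq']] := prime_over_principal (poly_ext_prime pQ) accX aQ.
have pC := contract_prime pq'; have iq' := prime_is_ideal pq'.
have CQ : contract q' `<=` Q by move=> x /q'Q /(poly_extC _ iQ).
have C0 : contract q' != [set 0] by apply: (@ideal_nonzero _ _ a).
have wC := prime_w pC C0 CQ wQ (prime_proper pQ).
have QC := max_w_eq (prime_w_max (conj pC wC)) wQ (prime_proper pQ) CQ.
have q'E : q' = poly_ext Q.
  by apply/seteqP; split=> //; apply: poly_ext_sub => // d; rewrite QC.
have qE : q = q'.
  apply: (principal_ideal_theorem pq' _ q'a radq' pq _ q0); last by rewrite q'E.
  exact: acc_saturatedS accX.
by move: q'a a0; rewrite -qE => /(upper_contract0 uq) ->; rewrite eqxx.
Qed.

(** Take [g] with [A g] maximal. Appending the coefficients of any [g'] in [q] leaves [A g]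
    unchanged, so a [Q] in [F g] would satisfy [q] inside [Q[X]]. *)
Lemma upper_content q (d : D) : upper_to_zero q -> d != 0 ->
  exists2 g, q g & forall Q, prime_w_ideal Q -> Q d -> ~ poly_ext Q g.
Proof.
move=> uq d0; have [pq q0 _] := uq; have iq := prime_is_ideal pq.
pose F g := [set Q : set D | [/\ prime_w_ideal Q, Q d & poly_ext Q g]].
pose A g := \bigcap_(Q in F g) Q.
have [||_ [[g [qg ->]] gmax]] := @acc_max _ _
  [set B | exists g, q g /\ B = A g] (A 0) accw.
- by move=> _ [g [_ ->]]; apply: (w_bigcap d0) => Q [[_ wQ] Qd _].
- by exists 0; split=> //; exact: ideal0.
exists g => // Q primeQ Qd Qg; apply: (upper_not_extended uq primeQ) => g' qg' i.
have [pQ _] := primeQ; have iQ := prime_is_ideal pQ.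
suff : A g g'`_i by apply.
rewrite -(gmax (A (g + 'X^(size g) * g'))).
- by move=> P [[pP _] _ /(poly_ext_add (prime_is_ideal pP)) [_]]; apply.
- by exists (g + 'X^(size g) * g'); split=> //; apply: idealD => //; apply: ideal_mull.
- move=> x Ax P [primeP Pd /(poly_ext_add _) Pg]; apply: Ax; split=> //.
  by case: Pg => //; apply: prime_is_ideal; case: primeP.
Qed.

(* If [g h] is divisible by [d] but [h] is not, then [(d : x h)], for [x] making
   it maximal, is a prime w-ideal, and it contains the content of [g]. *)
Lemma content_cancel (d : D) (g h : {poly D}) : d != 0 ->
  (forall Q, prime_w_ideal Q -> Q d -> ~ poly_ext Q g) ->
  poly_ext (principal d) (h * g) -> poly_ext (principal d) h.
Proof.
move=> d0 gQ hg; apply: contrapT => nh.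
pose A (x : D) := colon (principal d) (range (fun i => x * h`_i)).
have wd := w_principal d0; have idl := principal_ideal d.
have AE x y : A x y <-> poly_ext (principal d) ((y * x) *: h).
  split=> [Axy i|H _ [i _ <-]]; last by rewrite mulrA -coefZ.
  by rewrite coefZ -mulrA; apply: Axy; exists i.
have [||_ [[x [nx ->]] xmax]] := @acc_max _ _
  [set B | exists x, ~ poly_ext (principal d) (x *: h) /\ B = A x] (A 1) accw.
- by move=> _ [x [_ ->]]; apply: w_colon.
- by exists 1; rewrite scale1r.
have pA : prime_ideal (A x).
  apply: mkprime => [||y z /AE Ayz Ay]; first exact: colon_ideal.
    by move=> /AE; rewrite mul1r.
  rewrite -(xmax (A (y * x))).
  - by apply/AE; rewrite mulrCA mulrA.
  - by exists (y * x); split=> // /AE.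
  - by move=> u /AE Au; apply/AE => i; rewrite mulrCA -scalerA coefZ; apply: ideal_mull.
have wA : w_ideal (A x) by apply: w_colon.
have Ad : A x d by apply/AE => i; rewrite coefZ -mulrA; eexists.
have := gQ _ (conj pA wA) Ad => /(poly_top_coef (w_is_ideal wA)) [j nj Hj].
have [i ni Hi] := poly_top_coef idl nx.
(* Gauss's argument modulo [d]: the coefficients of [g] beyond [j] lie in [A x], so they multiply
   all of [x *: h] into [(d)]. *)
have hxg : principal d ((x *: h)`_i * g`_j).
  apply: (poly_top_coefM idl Hi).
    move=> l /Hj /AE Al k; have := Al k.
    by have -> : (x *: h)`_k * g`_l = ((g`_l * x) *: h)`_k by rewrite !coefZ; ring.
  by rewrite -scalerAl coefZ; apply: ideal_mull.
apply: nj.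
have <- : colon (principal d) [set (x *: h)`_i] = A x.
  apply: max_w_eq; [exact: prime_w_max|exact: w_colon| |].
    by move=> /(_ _ erefl); rewrite mul1r.
  by move=> y /AE /(_ i) H _ ->; rewrite coefZ mulrA -coefZ.
by move=> _ ->; rewrite mulrC.
Qed.

Lemma upper_maximal q : upper_to_zero q -> maximal_w_ideal q.
Proof.
move=> uq; have [pq _ _] := uq; have wq := upper_w uq.
apply: mk_max_w => // [|N wN N1 qN]; first exact: prime_proper pq.
apply: contrapT => nNq; have iN := w_is_ideal wN.
have [d d0 Nd] := above_upper_meets_base uq iN qN nNq.
have [g qg gQ] := upper_content uq d0.
apply: (w_no_GV (J := span [:: d%:P; g]) wN N1); last first.
  by apply: span_sub => // x; rewrite !inE => /orP[] /eqP -> //; apply: qN.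
apply: GV_span; first by exists d%:P; rewrite ?inE ?eqxx // polyC_eq0.
move=> a b b0 H.
have [|h hE] := H d%:P; first by rewrite inE eqxx.
have [|k kE] := H g; first by rewrite !inE eqxx orbT.
have hgE : h * g = d%:P * k.
  apply: (mulfI b0); rewrite mulrA -hE.
  have -> : b * (d%:P * k) = d%:P * (b * k) by ring.
  by rewrite -kE; ring.
(* Since [d] divides [h * g], it divides [h]; cancelling [d] in [a d = b h] shows that [b] divides
   [a]. *)
have [i|e eE] := choice (content_cancel d0 gQ (h := h) _).
  by rewrite hgE coefCM; eexists.
exists (\poly_(i < size h) e i); have dP0 : d%:P != 0 by rewrite polyC_eq0.
apply: (mulfI dP0); rewrite mulrC hE mulrCA; congr (_ * _).
apply/polyP => i; rewrite coefCM coef_poly; case: ltnP => [_|szh]; first exact: eE.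
by rewrite nth_default // mulr0.
Qed.

End UppersToZero.

Theorem corollary2p9 (D : idomainType) (hD : strong_Mori_domain D) :
  w_Hilbert_domain D <-> UMT_domain D.
Proof.
split=> [hilb q uq|]; last exact: UMT_w_Hilbert.
by apply: upper_maximal => // P; apply: w_Hilbert_maximal.
Qed.
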